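(* Let $a\in[-1,1]$, let $k\ge 0$ be an integer, and let $q\ge 2$ be an integer. Then $$b_{2k+1,q}(\psi(\cdot;a))=\alpha_{k,q}\,\frac{(2k+1)(4k+q+1)}{2k+q}\,(1-a),$$ $$b_{2k,q}(\psi(\cdot;a))=\alpha_{k,q}\,(4k+q-1)\,(1+a),$$ where $$\alpha_{k,q}=\frac{\Gamma(k+1/2)^2\,\Gamma((q-1)/2)^2}{2\pi\,\Gamma(k+q/2)^2}.$$
   Context: For $a\in[-1,1]$ and $\theta\in(0,\pi)$, let $\psi(\theta;a):=\cot(\theta/2)+a\tan(\theta/2)$. For integers $q\ge 2$ and $k\ge 0$, $C_k^{(q-1)/2}$ denotes the Gegenbauer polynomial of degree $k$ and index $(q-1)/2$ (standard normalization, generating function $\sum_{k\ge0}C_k^{\lambda}(x)t^k=(1-2xt+t^2)^{-\lambda}$). These satisfy $\int_{-1}^1 C_k^{(q-1)/2}(x)C_\ell^{(q-1)/2}(x)(1-x^2)^{q/2-1}\,\mathrm{d}x=\delta_{k,\ell}\,c_{k,q}$, where $$c_{k,q}:=\frac{\omega_q}{\omega_{q-1}}\Big(1+\frac{2k}{q-1}\Big)^{-2}d_{k,q},\qquad d_{k,q}:=\Big(1+\frac{2k}{q-1}\Big)C_k^{(q-1)/2}(1),$$ and $\omega_q:=2\pi^{(q+1)/2}/\Gamma((q+1)/2)$ is the area of the unit sphere $\mathbb{S}^q\subset\mathbb{R}^{q+1}$. The Gegenbauer coefficients of a function $\phi$ of the angle are $$b_{k,q}(\phi):=\frac{1}{c_{k,q}}\int_{-1}^{1}\phi(\cos^{-1}(x))\,C_k^{(q-1)/2}(x)\,(1-x^2)^{q/2-1}\,\mathrm{d}x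 .$$ *)

(* Defs.v *)
From HB Require Import structures.
From mathcomp Require Import all_boot all_order all_algebra.
From mathcomp Require Import all_classical all_reals all_analysis.

Set Implicit Arguments.
Unset Strict Implicit.
Unset Printing Implicit Defensive.

Import Order.TTheory GRing.Theory Num.Theory.
Import numFieldNormedType.Exports.

Local Open Scope classical_set_scope.
Local Open Scope ring_scope.

(* Euler's integral; only meaningful for 0 < z, where it converges. *)
Definition Gamma (R : realType) (z : R) : R :=
  \int[lebesgue_measure]_(t in `]0, +oo[) (t `^ (z - 1) * expR (- t)).

(* Area of the unit sphere S^q of R^(q+1). *)
Definition omega (R : realType) (q : nat) : R :=
  2 * pi `^ ((q%:R + 1) / 2) / Gamma ((q%:R + 1) / 2).

(* Coefficient of t^k in the expansion of (1 - 2xt + t^2)^(-lam) in powers of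
   t, as the Taylor coefficient at t = 0 (the base is positive near 0). *)
Definition gegenbauer (R : realType) (lam : R) (k : nat) (x : R) : R :=
  derive1n k (fun t : R => (1 - 2 * x * t + t ^+ 2) `^ (- lam)) 0 / k`!%:R.

Definition gegen_index (R : realType) (q : nat) : R := (q%:R - 1) / 2.

Definition gegen_d (R : realType) (k q : nat) : R :=
  (1 + (2 * k%:R) / (q%:R - 1)) * gegenbauer (gegen_index R q) k 1.

Definition gegen_c (R : realType) (k q : nat) : R :=
  omega R q / omega R q.-1 * (1 + (2 * k%:R) / (q%:R - 1)) ^- 2 *
  gegen_d R k q.

(* The value is an extended real, so that an equation stating that it is a
   given real number includes the convergence of the integral. *)
Definition gegen_coef (R : realType) (k q : nat) (phi : R -> R) : \bar R :=
  ((gegen_c R k q)^-1%:E *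
   \int[lebesgue_measure]_(x in `](- 1)%R, 1%R[)
     (phi (acos x) * gegenbauer (gegen_index R q) k x *
      (1 - x ^+ 2) `^ (q%:R / 2 - 1))%:E)%E.

Definition psi (R : realType) (a theta : R) : R :=
  cos (theta / 2) / sin (theta / 2) + a * tan (theta / 2).

Definition alpha (R : realType) (k q : nat) : R :=
  (Gamma (k%:R + 1 / 2) ^+ 2 * Gamma ((q%:R - 1) / 2) ^+ 2) /
  (2 * pi * Gamma (k%:R + q%:R / 2) ^+ 2).

(* Main.v *)
Require Import Defs.
From HB Require Import structures.
From mathcomp Require Import all_boot all_order all_algebra.
From mathcomp Require Import all_classical all_reals all_analysis.
From mathcomp Require Import measurable_realfun ring lra.

Import Order.TTheory GRing.Theory Num.Theory.
Import numFieldNormedType.Exports.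

Local Open Scope ring_scope.

(** Put lam = (q - 1) / 2.  The half-angle formulas give
    psi(acos x; a) = ((1 + a) + (1 - a) x) / sqrt (1 - x^2), so the integrand
    of b_n is ((1 + a) + (1 - a) x) C_n(x) w(x) with
    w(x) = (1 - x^2)^(lam - 1), and everything reduces to the two families
    I_n = int C_n w and J_n = int x C_n w over (-1, 1).

    Both come from one integration by parts.  For every polynomial p,
      ((1 - x^2)^lam p)' = ((1 - x^2) p' - 2 lam x p) w,
    and (1 - x^2)^lam vanishes at both ends, so the right-hand side integrates
    to 0 ([jacobi_integral_by_parts]).  For p = C_(n+1), the relation
      (1 - x^2) C_(n+1)' = (n + 2 lam) C_n - (n + 1) x C_(n+1)
    ([gegen_poly_deriv]) turns this into
    (n + 1 + 2 lam) J_(n+1) = (n + 2 lam) I_n ([gegen_moments]); inserting it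
    in the three-term recurrence of the C_n gives
      (n + 2)(n + 1 + 2 lam) I_(n+2) = (n + 1)(n + 2 lam) I_n
    ([gegen_integral_rec]).  Since J_0 = 0, the integrals of the wrong parity
    vanish, and the others are known as soon as I_0 is.  For p = x the same
    identity relates the I_0 of lam + 1 to that of lam; starting from
    lam = 1/2, where w is the derivative of the arcsine, and lam = 1, where
    w = 1, it yields I_0 Gamma(lam + 1/2) = Gamma(1/2) Gamma(lam)
    ([jacobi_integral_beta]).  The derivative relation at x = 1 also gives
    C_n(1), hence the normalization c_n ([gegen_cE]), and the quotients are
    Gamma factors.

    Two facts are needed about the objects involved.  The Taylor coefficients
    of f(t) = (1 - 2 x t + t^2)^(-lam) are polynomials obeying the three-term
    recurrence, because (1 - 2 x t + t^2) f' = 2 lam (x - t) f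
    ([gegenbauerE]).  And Gamma(z + 1) = z Gamma(z), Gamma(1) = 1,
    Gamma(1/2) = sqrt pi follow from Euler's integral.

    All these integrals are over open or unbounded intervals, and w is
    unbounded near the ends when q = 2.  Each is evaluated by the fundamental
    theorem of calculus on compact intervals exhausting the domain, the
    passage to the limit being justified either by positivity
    ([ge0_improper_FTC]) or by integrability ([integrable_improper_FTC]). *)

Set Implicit Arguments.
Unset Strict Implicit.
Unset Printing Implicit Defensive.

Local Open Scope classical_set_scope.
Local Open Scope ring_scope.

(** * Integrals over exhausted domains *)

Lemma integrable_nondecreasing_set_cvg d (T : measurableType d) (R : realType)
    (mu : {measure set T -> \bar R}) (D : (set T)^nat) (f : T -> \bar R) :
  nondecreasing_seq D -> (forall n, measurable (D n)) ->
  mu.-integrable (\bigcup_n D n) f ->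
  (\int[mu]_(x in D n) f x @[n --> \oo] --> \int[mu]_(x in \bigcup_n D n) f x)%E.
Proof.
move=> ndD mD fi.
have mfD n : measurable_fun (D n) f.
  apply: measurable_funS (measurable_int _ fi).
    exact: bigcupT_measurable.
  exact: bigcup_sup.
have cvgp := @ge0_nondecreasing_set_cvg_integral _ _ R D f^\+%E mu ndD mD
  (fun n => measurable_funepos (mfD n)) (fun n x _ => funepos_ge0 f x).
have cvgn := @ge0_nondecreasing_set_cvg_integral _ _ R D f^\-%E mu ndD mD
  (fun n => measurable_funeneg (mfD n)) (fun n x _ => funeneg_ge0 f x).
rewrite integralE; under eq_fun do rewrite integralE.
apply: cvgeB cvgp cvgn.
apply: fin_num_adde_defr.
apply: integrable_fin_num; first exact: bigcupT_measurable.
by apply: integrable_funepos => //; exact: bigcupT_measurable.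
Qed.

Section ImproperFTC.
Context {R : realType}.
Let mu : {measure set _ -> \bar R} := @lebesgue_measure R.

Variables (f F : R -> R) (u v : R^nat) (la lb : R).

Let D : set R := \bigcup_n `[u n, v n]%classic.

Hypothesis ltuv : forall n, u n < v n.
Hypothesis niu : nonincreasing_seq u.
Hypothesis ndv : nondecreasing_seq v.
Hypothesis dF : forall x, D x -> is_derive x 1 F (f x).
Hypothesis cf : forall x, D x -> {for x, continuous f}.
Hypothesis Fu : F (u n) @[n --> \oo] --> la.
Hypothesis Fv : F (v n) @[n --> \oo] --> lb.

(** On each piece the integral is F (v n) - F (u n). *)
Let cvg_FTC : (\int[mu]_(x in `[u n, v n]) (f x)%:E @[n --> \oo] --> (lb - la)%:E)%E.
Proof.
suff -> : (fun n => \int[mu]_(x in `[u n, v n]) (f x)%:E)%E =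
    (fun n => (F (v n) - F (u n))%:E).
  by apply: cvg_EFin; [exact: nearW|exact: cvgB Fv Fu].
apply/funext => n.
have sub x : x \in `[u n, v n] -> D x by move=> xuv; exists n.
have sub' x : x \in `]u n, v n[ -> D x.
  by move=> xuv; apply: sub; exact: subset_itv_oo_cc.
have cF x : D x -> {for x, continuous F}.
  move=> Dx; have dFx := dF Dx.
  by apply: differentiable_continuous; apply/derivable1_diffP.
have un : u n \in `[u n, v n] by rewrite bound_itvE ltW.
have vn : v n \in `[u n, v n] by rewrite bound_itvE ltW.
rewrite (continuous_FTC2 (F := F)) ?EFinB//.
- by apply: continuous_in_subspaceT => x; rewrite inE => /sub /cf.
- split => [x /sub' /dF []//||].
  + by apply: cvg_at_right_filter; apply/cF/sub.
  + by apply: cvg_at_left_filter; apply/cF/sub.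
- by move=> x /sub' /dF dFx; rewrite derive1E derive_val.
Qed.

Let nd_itv : nondecreasing_seq (fun n => [set` `[u n, v n]]).
Proof.
move=> m n mn; apply/subsetPset => x /=; rewrite !in_itv/= => /andP[ux xv].
by rewrite (le_trans (niu mn))//= (le_trans xv) ?ndv.
Qed.

Let mf n : measurable_fun `[u n, v n] (EFin \o f).
Proof.
apply/measurable_EFinP; apply: subspace_continuous_measurable_fun => //.
by apply: continuous_in_subspaceT => x; rewrite inE => xuv; apply: cf; exists n.
Qed.

Lemma measurable_improper : measurable_fun D f.
Proof.
have mD n : measurable `[u n, v n]%classic by [].
by apply/(measurable_fun_bigcup f mD) => n; apply/measurable_EFinP; exact: mf.
Qed.

Lemma ge0_improper_FTC : (forall x, D x -> 0 <= f x) ->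
  (\int[mu]_(x in D) (f x)%:E = (lb - la)%:E)%E.
Proof.
move=> f0; apply: cvg_unique cvg_FTC => //.
apply: ge0_nondecreasing_set_cvg_integral => // n x xuv.
by rewrite lee_fin f0//; exists n.
Qed.

Lemma integrable_improper : (forall x, D x -> 0 <= f x) ->
  mu.-integrable D (EFin \o f).
Proof.
move=> f0; apply/integrableP; split.
  by apply/measurable_EFinP; exact: measurable_improper.
under eq_integral => x /set_mem Dx do rewrite gee0_abs ?lee_fin ?f0//.
by rewrite /= ge0_improper_FTC// ltry.
Qed.

Lemma integrable_improper_FTC : mu.-integrable D (EFin \o f) ->
  (\int[mu]_(x in D) (f x)%:E = (lb - la)%:E)%E.
Proof.
move=> fi; apply: cvg_unique cvg_FTC => //.
exact: integrable_nondecreasing_set_cvg.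
Qed.

End ImproperFTC.

(** * The Gamma function *)

Section GammaFunction.
Context {R : realType}.
Let mu : {measure set _ -> \bar R} := @lebesgue_measure R.

Lemma is_derive_continuous (f : R -> R) (x df : R) :
  is_derive x 1 f df -> {for x, continuous f}.
Proof.
by move=> dfx; apply: differentiable_continuous; apply/derivable1_diffP.
Qed.

Lemma itv0y_bigcup :
  `]0, +oo[%classic = \bigcup_n `[n.+1%:R^-1, n.+2%:R]%classic :> set R.
Proof.
apply/seteqP; split => [x|x [n _]] /=; rewrite !in_itv/= ?andbT; last first.
  by case/andP => + _; apply: lt_le_trans; rewrite invr_gt0.
move=> x0.
have xV0 : 0 <= x^-1 by rewrite invr_ge0 ltW.
exists (maxn (Num.bound x) (Num.bound x^-1)) => //=; rewrite in_itv/=.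
apply/andP; split.
  rewrite invf_ple ?posrE//.
  rewrite (le_trans (ltW (archi_boundP xV0)))// ler_nat.
  by rewrite (leq_trans (leq_maxr _ _) (leqnSn _)).
rewrite (le_trans (ltW (archi_boundP (ltW x0))))// ler_nat.
by rewrite (leq_trans (leq_maxl _ _) (leq_trans (leqnSn _) (leqnSn _))).
Qed.

Section FTC0y.
Variables (f F : R -> R) (la lb : R).
Hypothesis dF : forall x : R, 0 < x -> is_derive x 1 F (f x).
Hypothesis cf : forall x : R, 0 < x -> {for x, continuous f}.
Hypothesis Fa : F x @[x --> 0^'+] --> la.
Hypothesis Fb : F x @[x --> +oo] --> lb.

Let u n : R := n.+1%:R^-1.
Let v n : R := n.+2%:R.

Let ltuv n : u n < v n.
Proof. by rewrite (@le_lt_trans _ _ 1) ?ltr1n// invf_le1// ler1n. Qed.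

Let niu : nonincreasing_seq u.
Proof. by move=> m n mn; rewrite lef_pV2 ?posrE// ler_nat. Qed.

Let ndv : nondecreasing_seq v.
Proof. by move=> m n mn; rewrite ler_nat. Qed.

Let Fu : F (u n) @[n --> \oo] --> la.
Proof.
move/cvg_at_rightP : Fa; apply; split; first by move=> n; rewrite invr_gt0.
exact: cvg_harmonic.
Qed.

Let Fv : F (v n) @[n --> \oo] --> lb.
Proof.
move/cvg_pinftyP : Fb; apply.
by have := @cvgr_idn R; rewrite -(cvg_shiftn 2)/=; under eq_fun do rewrite addn2.
Qed.

Let gt0 x : (\bigcup_n `[u n, v n]%classic) x -> 0 < x.
Proof. by rewrite -itv0y_bigcup /= in_itv/= andbT. Qed.

Let dF' x (xD : (\bigcup_n `[u n, v n]%classic) x) := dF (gt0 xD).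
Let cf' x (xD : (\bigcup_n `[u n, v n]%classic) x) := cf (gt0 xD).

Lemma ge0_FTC0y : (forall x : R, 0 < x -> 0 <= f x) ->
  (\int[mu]_(x in `]0%R, +oo[) (f x)%:E = (lb - la)%:E)%E.
Proof.
move=> f0; rewrite itv0y_bigcup.
by apply: (ge0_improper_FTC ltuv niu ndv dF' cf' Fu Fv) => x /gt0 /f0.
Qed.

Lemma integrable0y : (forall x : R, 0 < x -> 0 <= f x) ->
  mu.-integrable `]0, +oo[ (EFin \o f).
Proof.
move=> f0; rewrite itv0y_bigcup.
by apply: (integrable_improper ltuv niu ndv dF' cf' Fu Fv) => x /gt0 /f0.
Qed.

Lemma integrable_FTC0y : mu.-integrable `]0, +oo[ (EFin \o f) ->
  (\int[mu]_(x in `]0%R, +oo[) (f x)%:E = (lb - la)%:E)%E.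
Proof.
rewrite itv0y_bigcup => fi.
exact: (integrable_improper_FTC ltuv niu ndv dF' cf' Fu Fv).
Qed.

End FTC0y.

(** (1 + t)^N is at most N! exp (1 + t), a single term of the exponential
    series. *)
Lemma bounded_powR_expRN (p : R) :
  exists C, forall t : R, 0 <= t -> (1 + t) `^ p * expR (- t) <= C.
Proof.
pose N := Num.bound `|p|.
exists (N.+1`!%:R * expR 1) => t t0.
have t1 : 1 <= 1 + t by rewrite lerDl.
have t10 : 0 <= 1 + t by rewrite (le_trans ler01).
have pN : p <= N.+1%:R.
  by rewrite (le_trans (ler_norm _))// (le_trans (ltW (archi_boundP _)))?ler_nat.
rewrite expRN ler_pdivrMr ?expR_gt0// -mulrA -expRD.
rewrite (le_trans (ler_powR t1 pN))// powR_mulrn// -ler_pdivrMl ?ltr0n ?fact_gt0//.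
rewrite mulrC; apply: le_trans (expR_ge1Dxn N t10).
by rewrite lerDr.
Qed.

(** The antiderivative behind Gamma (z + 1) = z Gamma z. *)
Lemma is_derive_powR_expRN (z t : R) : 0 < t ->
  is_derive t 1 (fun t => t `^ z * expR (- t))
    (z * (t `^ (z - 1) * expR (- t)) - t `^ z * expR (- t)).
Proof.
move=> t0; have dp := is_derive1_powR z t0.
have de : is_derive t 1 (fun t : R => expR (- t)) (expR (- t) * -1).
  exact: (@is_derive1_comp _ expR -%R).
apply: is_derive_eq (is_deriveM dp de) _.
by rewrite /GRing.scale/=; ring.
Qed.

Lemma continuous_powR_expRN (z t : R) : 0 < t ->
  {for t, continuous (fun t => t `^ z * expR (- t))}.
Proof. by move=> /(is_derive_powR_expRN z); exact: is_derive_continuous. Qed.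

Lemma cvg0_powR_expRN (z : R) : 0 < z ->
  t `^ z * expR (- t) @[t --> 0^'+] --> (0 : R).
Proof.
move=> z0; rewrite -[X in _ --> X](mul0r (expR (- 0))).
apply: cvgM; first exact: powR_cvg0.
apply: cvg_at_right_filter.
by apply: (@continuous_comp _ _ _ -%R expR); [exact: opp_continuous|exact: continuous_expR].
Qed.

Lemma cvgy_powR_expRN (z : R) : 0 < z ->
  t `^ z * expR (- t) @[t --> +oo] --> (0 : R).
Proof.
move=> z0; have [C bC] := bounded_powR_expRN (z + 1).
have cC : C / t @[t --> +oo] --> (0 : R).
  rewrite -(mulr0 C); apply: cvgM; first exact: cvg_cst.
  by apply/gtr0_cvgV0; [exact: nbhs_pinfty_gt|exact: cvg_id].
apply: (squeeze_cvgr _ (cvg_cst 0) cC); near=> t.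
have t0 : 0 < t by [].
rewrite mulr_ge0 ?powR_ge0 ?expR_ge0//= ler_pdivlMr//.
apply: le_trans (bC t (ltW t0)); rewrite mulrAC ler_wpM2r ?expR_ge0//.
have -> : t `^ z * t = t `^ (z + 1).
  by rewrite powRD ?powRr1 ?ltW// (gt_eqF t0) implybT.
rewrite ge0_ler_powR//.
- by rewrite addr_ge0// ltW.
- by rewrite nnegrE ltW.
- by rewrite nnegrE addr_ge0// ltW.
- by rewrite lerDr.
Unshelve. all: end_near. Qed.

(** With s = t / (1 + t), the function s ^ z increases from 0 to 1 and has
    derivative z t^(z - 1) / (1 + t)^(z + 1).  This dominates the integrand up
    to a constant, both near 0 and near infinity. *)
Lemma integrable_powR_expRN (z : R) : 0 < z ->
  mu.-integrable `]0, +oo[ (EFin \o (fun t => t `^ (z - 1) * expR (- t))).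
Proof.
move=> z0; have [C bC] := bounded_powR_expRN (z + 1).
pose s (t : R) := t * (1 + t)^-1.
pose h (t : R) := z * s t `^ (z - 1) * (1 + t) ^- 2.
have s0 t : 0 < t -> 0 < s t by move=> t0; rewrite divr_gt0// addr_gt0.
have dV (t : R) : 0 < t -> is_derive t 1 (fun t : R => (1 + t)^-1) (- (1 + t) ^- 2).
  move=> t0; have t1 : 1 + t != 0 by rewrite gt_eqF// addr_gt0.
  have d1 : is_derive t 1 (fun t : R => 1 + t) (0 + 1).
    by apply: is_deriveD.
  by apply: is_derive_eq (is_deriveV t1 d1) _; rewrite /GRing.scale/= add0r mulr1.
have ds (t : R) : 0 < t -> is_derive t 1 s ((1 + t) ^- 2).
  move=> t0; have t1 : 1 + t != 0 by rewrite gt_eqF// addr_gt0.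
  apply: is_derive_eq (is_deriveM (is_derive_id t 1) (dV t t0)) _.
  by rewrite /GRing.scale/=; field.
have dF (t : R) : 0 < t -> is_derive t 1 (fun t => s t `^ z) (h t).
  move=> t0.
  have dsz := is_derive1_powR z (s0 t t0).
  have dst := ds t t0.
  exact: (@is_derive1_comp _ (fun x => x `^ z) s _ _ _ dsz dst).
have ch (t : R) : 0 < t -> {for t, continuous h}.
  move=> t0; apply: cvgM.
    apply: cvgM; first exact: cvg_cst.
    apply: (@continuous_comp _ _ _ s (fun x => x `^ (z - 1))).
      exact: is_derive_continuous (ds t t0).
    exact: is_derive_continuous (is_derive1_powR _ (s0 t t0)).
  have cV := is_derive_continuous (dV t t0).
  have E : (fun x : R => (1 + x) ^- 2) = (fun x => (1 + x)^-1 * (1 + x)^-1).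
    by apply/funext => x; rewrite -expr2 exprVn.
  by rewrite -[_ ^- 2]/((fun x : R => (1 + x) ^- 2) t) E; exact: cvgM.
have h0 t : 0 < t -> 0 <= h t.
  move=> t0; rewrite mulr_ge0 ?invr_ge0 ?sqr_ge0// mulr_ge0 ?powR_ge0//.
  exact: ltW.
have sV t : 0 < t -> s t = 1 - (1 + t)^-1.
  move=> t0; have t1 : 1 + t != 0 by rewrite gt_eqF// addr_gt0.
  by rewrite /s; field.
have ih : mu.-integrable `]0, +oo[ (EFin \o h).
  apply: (@integrable0y _ _ 0 1 dF ch _ _ h0).
  - apply: (squeeze_cvgr _ (cvg_cst 0) (powR_cvg0 z0)); near=> t.
    have t0 : 0 < t by [].
    rewrite powR_ge0/= ge0_ler_powR ?nnegrE ?ltW ?s0//.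
    by rewrite ltr_pdivrMr ?addr_gt0// ltr_pMr// ltrDl.
  - have s1 : s t @[t --> +oo] --> (1 : R).
      rewrite -[X in _ --> X]subr0.
      apply: (@cvg_trans _ ((1 - (1 + t)^-1) @[t --> +oo])).
        by apply: near_eq_cvg; near=> t; rewrite sV.
      apply: cvgB; first exact: cvg_cst.
      apply/gtr0_cvgV0; first by near=> t; rewrite addr_gt0.
      apply/cvgryPge => M; near=> t; rewrite -lerBlDl.
      by near: t; apply: nbhs_pinfty_ge; exact: num_real.
    rewrite [X in _ --> X](_ : 1 = 1 `^ z); last by rewrite powR1.
    apply: (@continuous_cvg _ _ _ _ _ s (fun x => x `^ z) 1 _ s1).
    exact: is_derive_continuous (is_derive1_powR z ltr01).
have hD : mu.-integrable `]0, +oo[ (EFin \o (fun t => (C / z) * h t)).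
  exact: (integrableZl _ _ ih).
apply: le_integrable hD => //.
  apply/measurable_EFinP; apply: measurable_funM; last first.
    by apply: measurableT_comp => //; exact: measurableT_comp.
  exact: measurable_funTS.
move=> t /=; rewrite in_itv/= andbT => t0.
have t10 : 0 < 1 + t by rewrite addr_gt0.
have C0 : 0 <= C.
  by apply: le_trans (bC 0 (lexx 0)); rewrite mulr_ge0 ?powR_ge0 ?expR_ge0.
have g_ge0 : 0 <= t `^ (z - 1) * expR (- t) by rewrite mulr_ge0 ?powR_ge0 ?expR_ge0.
have Ch_ge0 : 0 <= C / z * h t by rewrite mulr_ge0 ?h0// divr_ge0// ltW.
rewrite lee_fin !ger0_norm//.
have -> : C / z * h t = s t `^ (z - 1) * (1 + t) ^- 2 * C.
  by rewrite /h; field; rewrite !gt_eqF.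
have -> : t `^ (z - 1) * expR (- t) =
    s t `^ (z - 1) * (1 + t) ^- 2 * ((1 + t) `^ (z + 1) * expR (- t)).
  have -> : z + 1 = (z - 1) + 2 by ring.
  rewrite [(1 + t) `^ _]powRD; last by rewrite (gt_eqF t10) implybT.
  rewrite powR_mulrn ?(ltW t10)//.
  have {1}-> : t = s t * (1 + t) by rewrite /s divfK// gt_eqF.
  rewrite powRM ?(ltW t10) ?(ltW (s0 t t0))//.
  by field; rewrite gt_eqF.
apply: ler_wpM2l; last exact: bC (ltW t0).
by rewrite mulr_ge0 ?powR_ge0// invr_ge0 exprn_ge0// ltW.
Unshelve. all: end_near. Qed.

Lemma fine_Gamma (z : R) : 0 < z ->
  (\int[mu]_(t in `]0%R, +oo[) (t `^ (z - 1) * expR (- t))%:E = (Gamma z)%:E)%E.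
Proof.
by move=> z0; rewrite fineK//; apply: integrable_fin_num => //; exact: integrable_powR_expRN.
Qed.

(** The derivative of t^z exp (- t) changes sign, so integrability of its two
    terms is what allows it to be integrated over the half-line. *)
Lemma Gamma_add1 (z : R) : 0 < z -> Gamma (z + 1) = z * Gamma z.
Proof.
move=> z0; have z10 : 0 < z + 1 by rewrite addr_gt0.
have := @integrable_FTC0y _ _ 0 0 (fun t => is_derive_powR_expRN z (t := t)).
have ig := integrable_powR_expRN z0.
have := integrable_powR_expRN z10; rewrite addrK => ig1.
have izg : mu.-integrable `]0, +oo[ (EFin \o (fun t => z * (t `^ (z - 1) * expR (- t)))).
  exact: (integrableZl _ _ ig).
move=> /(_ _ (cvg0_powR_expRN z0) (cvgy_powR_expRN z0)).
rewrite subr0 => H.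
have : (\int[mu]_(t in `]0%R, +oo[) ((z * (t `^ (z - 1) * expR (- t)))%:E
   - (t `^ z * expR (- t))%:E) = 0)%E.
  rewrite -[RHS]H//; last exact: (integrableB _ izg ig1).
  move=> t t0; apply: cvgB; last exact: continuous_powR_expRN.
  by apply: cvgM; [exact: cvg_cst|exact: continuous_powR_expRN].
rewrite integralB// => /eqP.
have := fine_Gamma z10; rewrite addrK => ->.
under eq_integral do rewrite EFinM.
rewrite integralZl// fine_Gamma//.
by rewrite -EFinM -EFinB eqe subr_eq0 => /eqP.
Qed.

Lemma Gamma1 : Gamma 1 = 1 :> R.
Proof.
apply: EFin_inj; rewrite -fine_Gamma//.
rewrite (_ : 1%:E = (0 - (- 1))%:E)%E; last by rewrite sub0r opprK.
under eq_integral do rewrite subrr powRr0 mul1r.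
have dF (t : R) : 0 < t -> is_derive t 1 (fun t => - expR (- t)) (expR (- t)).
  move=> _; have de : is_derive t 1 (fun t : R => expR (- t)) (expR (- t) * -1).
    exact: (@is_derive1_comp _ expR -%R).
  by apply: is_derive_eq (is_deriveN de) _; rewrite mulrN1 opprK.
have ce : continuous (fun t : R => expR (- t)).
  move=> t; apply: (@continuous_comp _ _ _ -%R expR).
    exact: opp_continuous.
  exact: continuous_expR.
apply: (ge0_FTC0y dF).
- by move=> x _; exact: ce.
- apply: cvg_at_right_filter.
  rewrite [X in _ --> X](_ : -1 = - expR (- 0)); last by rewrite oppr0 expR0.
  by apply: cvgN; exact: ce.
- by rewrite -oppr0; apply: cvgN; exact: cvgr_expR.
- by move=> t _; exact: expR_ge0.
Qed.

Let G (x : R) := gauss_integral_proof.integral0_gauss x.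

Let integrable_gauss (x : R) : mu.-integrable `[0, x] (EFin \o gauss_fun).
Proof.
apply: continuous_compact_integrable; first exact: segment_compact.
by apply: continuous_subspaceT; exact: continuous_gauss_fun.
Qed.

Let is_derive_G (x : R) : 0 < x -> is_derive x 1 G (gauss_fun x).
Proof.
move=> x0; have x1 : x < x + 1 by rewrite ltrDl.
have [dG Gx] := continuous_FTC1_closed x1 (integrable_gauss (x + 1)) x0
  (@continuous_gauss_fun R x).
by apply: DeriveDef; rewrite // -derive1E.
Qed.

Let cvgy_G : G x @[x --> +oo] --> Num.sqrt pi / 2.
Proof.
have := @cvg_comp _ _ _ _ Num.sqrt _ _ _ (@gauss_integral_proof.cvg_integral0_gauss_sqr R)
  (@sqrt_continuous R (pi / 4)).
rewrite sqrtrM ?pi_ge0// sqrtrV// (_ : 4 = 2 ^+ 2); last by ring.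
rewrite sqrtr_sqr ger0_norm//; apply: cvg_trans; apply: near_eq_cvg.
near=> x; rewrite /= sqrtr_sqr ger0_norm//.
exact: gauss_integral_proof.integral0_gauss_ge0.
Unshelve. all: end_near. Qed.

Let cvg0_G : G x @[x --> 0^'+] --> (0 : R).
Proof.
apply: cvg_at_right_filter.
exact: (parameterized_integral_cvg_left ltr01 (integrable_gauss 1)).
Qed.

(** The substitution t = x^2 in the Gaussian integral: 2 G (sqrt t), with G the
    antiderivative of exp (- x^2), is an antiderivative of
    t^(- 1/2) exp (- t). *)
Lemma Gamma_half : Gamma (1 / 2) = Num.sqrt pi :> R.
Proof.
apply: EFin_inj; rewrite -fine_Gamma//.
rewrite (_ : (Num.sqrt pi)%:E = (2 * (Num.sqrt pi / 2) - 2 * 0)%:E)%E; last first.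
  by congr EFin; lra.
have dF (t : R) : 0 < t -> is_derive t 1 (fun t => 2 * G (Num.sqrt t))
    (t `^ (1 / 2 - 1) * expR (- t)).
  move=> t0; have s0 : 0 < Num.sqrt t by rewrite sqrtr_gt0.
  have dGs := is_derive1_comp (is_derive_G s0) (is_derive1_sqrt t0).
  apply: is_derive_eq (is_deriveM (is_derive_cst (2 : R) t 1) dGs) _.
  rewrite scaler0 addr0 /GRing.scale/= /gauss_fun sqr_sqrtr ?ltW//.
  have -> : 1 / 2 - 1 = - 2^-1 :> R by lra.
  rewrite powRN powR12_sqrt ?ltW//.
  by field; rewrite gt_eqF.
apply: (ge0_FTC0y dF).
- by move=> x x0; exact: continuous_powR_expRN.
- apply: cvgM; first exact: cvg_cst.
  apply/cvg_at_rightP => u [u0 cu]; move/cvg_at_rightP : cvg0_G; apply.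
  split=> [n|]; first by rewrite sqrtr_gt0.
  by rewrite -[X in _ --> X](@sqrtr0 R); apply: continuous_cvg cu; exact: sqrt_continuous.
- apply: cvgM; first exact: cvg_cst.
  apply: cvg_comp cvgy_G; apply/cvgryPge => M.
  have [M0|M0] := leP M 0; near=> t; first by rewrite (le_trans M0)// sqrtr_ge0.
  have Mt : M ^+ 2 <= t by near: t; apply: nbhs_pinfty_ge; exact: num_real.
  by rewrite -(ger0_norm (ltW M0)) -sqrtr_sqr ler_wsqrtr.
- by move=> x x0; rewrite mulr_ge0 ?powR_ge0 ?expR_ge0.
Unshelve. all: end_near. Qed.

Lemma Gamma_halfn_gt0 n : 0 < Gamma (n.+1%:R / 2) :> R.
Proof.
elim/ltn_ind: n => -[_|[_|n ih]].
- by rewrite Gamma_half sqrtr_gt0 pi_gt0.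
- by rewrite divff// Gamma1.
- have -> : n.+3%:R / 2 = n.+1%:R / 2 + 1 :> R by rewrite -addn2 natrD; field.
  by rewrite Gamma_add1 ?mulr_gt0 ?ih.
Qed.

End GammaFunction.

(** * Gegenbauer polynomials *)

Lemma is_derive_derive1n (R : realType) n (f : R -> R) (t : R) :
  derivable (derive1n n f) t 1 ->
  is_derive t 1 (derive1n n f) (derive1n n.+1 f t).
Proof. by move=> df; apply: DeriveDef; [exact: df|rewrite derive1nS derive1E]. Qed.

Section GegenbauerPolynomials.
Context {R : realType}.
Variable lam : R.

(** Two consecutive polynomials, so that the three-term recurrence is a
    structural recursion. *)
Fixpoint gegen_poly_pair (n : nat) : {poly R} * {poly R} :=
  if n is m.+1 then
    let: (p, p') := gegen_poly_pair m in
    (p', (m.+2%:R^-1)%:P *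
         (2 * (m.+1%:R + lam%:P) * 'X * p' - (m%:R + 2 * lam%:P) * p))
  else (1, 2 * lam%:P * 'X).

Definition gegen_poly n := (gegen_poly_pair n).1.

Local Notation P := gegen_poly.

Lemma gegen_poly0 : P 0 = 1. Proof. by []. Qed.

Lemma gegen_poly1 : P 1 = 2 * lam%:P * 'X. Proof. by []. Qed.

Lemma gegen_polySS n : P n.+2 = (n.+2%:R^-1)%:P *
  (2 * (n.+1%:R + lam%:P) * 'X * P n.+1 - (n%:R + 2 * lam%:P) * P n).
Proof.
rewrite /gegen_poly /=.
have -> : (gegen_poly_pair n.+1).1 = (gegen_poly_pair n).2.
  by rewrite /=; case: (gegen_poly_pair n).
by case: (gegen_poly_pair n).
Qed.

Let natr_poly_neq0 n : n.+1%:R != 0 :> {poly R}.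
Proof. by rewrite -polyC_natr polyC_eq0 pnatr_eq0. Qed.

Lemma gegen_poly_rec n : n.+2%:R * P n.+2 =
  2 * (n.+1%:R + lam%:P) * 'X * P n.+1 - (n%:R + 2 * lam%:P) * P n.
Proof.
by rewrite gegen_polySS mulrA -polyC_natr -polyCM divff ?pnatr_eq0// polyC1 mul1r.
Qed.

(** x C_(n+1)' - C_n' = (n + 1) C_(n+1) and C_(n+1)' - x C_n' = (n + 2 lam) C_n
    have to be proved together: differentiating the recurrence and using the
    first gives the second at the next index, and the two combine into the
    formula for (1 - x^2) C_(n+1)', which gives the first at the next index. *)
Let deriv_aux n :
  'X * (P n.+1)^`() - (P n)^`() = n.+1%:R * P n.+1 /\
  (P n.+1)^`() - 'X * (P n)^`() = (n%:R + 2 * lam%:P) * P n.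
Proof.
elim: n => [|n [A B]].
  rewrite gegen_poly1 gegen_poly0 derivC derivM derivX derivM derivC.
  rewrite -polyC_natr derivC; split; ring.
have N2 : n.+2%:R = n%:R + 2 :> {poly R} by rewrite -addn2 natrD.
have N1 : n.+1%:R = n%:R + 1 :> {poly R} by rewrite -addn1 natrD.
have dr : n.+2%:R * (P n.+2)^`() =
    2 * (n.+1%:R + lam%:P) * (P n.+1 + 'X * (P n.+1)^`()) -
    (n%:R + 2 * lam%:P) * (P n)^`().
  have := congr1 (@deriv R) (gegen_poly_rec n).
  have -> : 2 * (n.+1%:R + lam%:P) = (2 * (n.+1%:R + lam))%:P.
    by rewrite polyCM polyC_natr polyCD polyC_natr.
  have -> : n%:R + 2 * lam%:P = (n%:R + 2 * lam)%:P.
    by rewrite polyCD polyC_natr polyCM polyC_natr.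
  rewrite -polyC_natr derivB !derivM !derivC derivX => H.
  by apply: etrans (etrans H _); ring.
have C : (1 - 'X^2) * (P n.+1)^`() =
    (n%:R + 2 * lam%:P) * P n - n.+1%:R * 'X * P n.+1.
  have -> : (1 - 'X^2) * (P n.+1)^`() = ((P n.+1)^`() - 'X * (P n)^`()) -
      'X * ('X * (P n.+1)^`() - (P n)^`()) by ring.
  by rewrite A B; ring.
have B' : (P n.+2)^`() - 'X * (P n.+1)^`() = (n.+1%:R + 2 * lam%:P) * P n.+1.
  apply: (mulfI (natr_poly_neq0 n.+1)).
  rewrite mulrBr dr.
  have -> : (P n)^`() = 'X * (P n.+1)^`() - n.+1%:R * P n.+1 by rewrite -A; ring.
  by rewrite N2 N1; ring.
split; last exact: B'.
rewrite gegen_poly_rec.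
have -> : 'X * (P n.+2)^`() - (P n.+1)^`() =
    'X * ((P n.+2)^`() - 'X * (P n.+1)^`()) - (1 - 'X^2) * (P n.+1)^`() by ring.
by rewrite B' C N1; ring.
Qed.

Lemma gegen_poly_deriv n : (1 - 'X^2) * (P n.+1)^`() =
  (n%:R + 2 * lam%:P) * P n - n.+1%:R * 'X * P n.+1.
Proof.
have [A B] := deriv_aux n.
have -> : (1 - 'X^2) * (P n.+1)^`() = ((P n.+1)^`() - 'X * (P n)^`()) -
    'X * ('X * (P n.+1)^`() - (P n)^`()) by ring.
by rewrite A B; ring.
Qed.

Lemma gegen_poly_recE n x : n.+2%:R * (P n.+2).[x] =
  2 * (n.+1%:R + lam) * x * (P n.+1).[x] - (n%:R + 2 * lam) * (P n).[x].
Proof.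
by have := congr1 (horner^~ x) (gegen_poly_rec n); rewrite -!polyC_natr !hornerE.
Qed.

Lemma gegen_poly_derivE n x : (1 - x ^+ 2) * (P n.+1)^`().[x] =
  (n%:R + 2 * lam) * (P n).[x] - n.+1%:R * x * (P n.+1).[x].
Proof.
by have := congr1 (horner^~ x) (gegen_poly_deriv n); rewrite -!polyC_natr !hornerE.
Qed.

(** At x = 1 the derivative drops out of [gegen_poly_deriv]. *)
Lemma gegen_poly_at1 n : n.+1%:R * (P n.+1).[1] = (n%:R + 2 * lam) * (P n).[1].
Proof.
have := gegen_poly_derivE n 1; rewrite expr1n subrr mul0r mulr1.
by move/esym/eqP; rewrite subr_eq0 => /eqP.
Qed.

Section GeneratingFunction.
Variable x : R.

Let Q (t : R) := 1 - 2 * x * t + t ^+ 2.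
Let f (t : R) := Q t `^ (- lam).

Let dQ (t : R) : is_derive t 1 Q (2 * (t - x)).
Proof.
have dl : is_derive t 1 (fun t : R => 1 - 2 * x * t) (0 - 2 * x * 1).
  exact: is_deriveB (is_derive_cst (1 : R) t 1) (is_deriveZ (2 * x) (is_derive_id t 1)).
have dq : is_derive t 1 (fun t : R => t ^+ 2) (2%:R * t).
  by apply: is_derive_eq (is_deriveX 2 (is_derive_id t 1)) _; rewrite /GRing.scale/= mulr1 expr1.
by apply: is_derive_eq (is_deriveD dl dq) _; ring.
Qed.

Let Q_near (t : R) : 0 < Q t -> \forall s \near t, 0 < Q s.
Proof. by move=> Qt; exact: (cvgr_gt _ (is_derive_continuous (dQ t))). Qed.

(** Differentiating Q f' = 2 lam (x - t) f, n times.  The differential equation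
    is kept on the whole open set where Q > 0, not only at 0, since it is what
    shows that the next derivative exists: it writes it as a differentiable
    function divided by Q.  At n = 0 the last term vanishes, whatever the
    meaning of n.-1. *)
Let derive1n_generating n (t : R) : 0 < Q t ->
  [/\ derivable (derive1n n f) t 1,
     derivable (derive1n n.-1 f) t 1 &
     Q t * derive1n n.+1 f t = 2 * (n%:R + lam) * (x - t) * derive1n n f t
       - n%:R * (n%:R - 1 + 2 * lam) * derive1n n.-1 f t].
Proof.
elim: n t => [|n ih] t Qt.
  have df : is_derive t 1 f (- lam * Q t `^ (- lam - 1) * (2 * (t - x))).
    exact: (@is_derive1_comp _ (fun y => y `^ (- lam)) Q _ _ _ (is_derive1_powR _ Qt) (dQ t)).
  split; [exact: ex_derive|exact: ex_derive|].
  rewrite derive1n1 derive1n0 derive1E derive_val /f.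
  have -> : Q t `^ (- lam) = Q t * Q t `^ (- lam - 1).
    rewrite -{2}[Q t]powRr1 ?ltW// -powRD ?(gt_eqF Qt) ?implybT//.
    by congr powR; ring.
  by ring.
have [dn dn1 _] := ih t Qt.
have dfn : is_derive t 1 (derive1n n f) (derive1n n.+1 f t).
  exact: is_derive_derive1n.
have dx : is_derive t 1 (fun s : R => x - s) (0 - 1) by exact: is_deriveB.
have dfn1 : is_derive t 1 (fun s => n%:R * derive1n n.-1 f s) (n%:R * derive1n n f t).
  have dfp : is_derive t 1 (derive1n n.-1 f) (derive1n n.-1.+1 f t).
    exact: is_derive_derive1n.
  apply: is_derive_eq (is_deriveZ n%:R dfp) _.
  by case: (n) => [|m]; rewrite ?scale0r ?mul0r.
pose g s := 2 * (n%:R + lam) * ((x - s) * derive1n n f s) -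
  (n%:R - 1 + 2 * lam) * (n%:R * derive1n n.-1 f s).
have dg : is_derive t 1 g
    (2 * (n%:R + lam) * ((x - t) * derive1n n.+1 f t - derive1n n f t) -
     (n%:R - 1 + 2 * lam) * (n%:R * derive1n n f t)).
  apply: is_derive_eq (is_deriveB (is_deriveZ (2 * (n%:R + lam)) (is_deriveM dx dfn))
    (is_deriveZ (n%:R - 1 + 2 * lam) dfn1)) _.
  by rewrite /GRing.scale/=; ring.
have gE : \forall s \near t, g s = Q s * derive1n n.+1 f s.
  near=> s; have Qs : 0 < Q s by near: s; exact: Q_near.
  by have [_ _ ->] := ih s Qs; rewrite /g; ring.
have Qt0 : Q t != 0 by rewrite gt_eqF.
have dfS : derivable (derive1n n.+1 f) t 1.
  have dgQ := is_deriveM dg (is_deriveV Qt0 (dQ t)).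
  apply: (near_eq_derivable _ (ex_derive (is_derive := dgQ))).
  near=> s; have Qs : 0 < Q s by near: s; exact: Q_near.
  have gs : g s = Q s * derive1n n.+1 f s by near: s.
  by rewrite fctE/= gs mulrAC divff ?mul1r// gt_eqF.
have dfS2 : is_derive t 1 (derive1n n.+1 f) (derive1n n.+2 f t).
  exact: is_derive_derive1n.
split; [exact: dfS|exact: dn|].
have dg' := near_eq_is_derive gE dg.
have dQf := is_deriveM (dQ t) dfS2.
have H : Q t * derive1n n.+2 f t + derive1n n.+1 f t * (2 * (t - x)) =
    2 * (n%:R + lam) * ((x - t) * derive1n n.+1 f t - derive1n n f t) -
    (n%:R - 1 + 2 * lam) * (n%:R * derive1n n f t).
  exact: etrans (esym (@derive_val _ _ _ _ _ _ _ dQf)) (@derive_val _ _ _ _ _ _ _ dg').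
have {}H : Q t * derive1n n.+2 f t = 
    2 * (n%:R + lam) * ((x - t) * derive1n n.+1 f t - derive1n n f t) -
     (n%:R - 1 + 2 * lam) * (n%:R * derive1n n f t) - derive1n n.+1 f t * (2 * (t - x)).
  by rewrite -H; ring.
by rewrite H -[n.+1%:R]natr1; ring.
Unshelve. all: end_near. Qed.

(** At t = 0, where Q = 1, the differentiated equation divided by (n + 2)! is
    the three-term recurrence. *)
Lemma gegenbauerE n : gegenbauer lam n x = (P n).[x].
Proof.
have Q0 : Q 0 = 1 by rewrite /Q; ring.
have Q0_gt0 : 0 < Q 0 by rewrite Q0.
have f0 : f 0 = 1 by rewrite /f Q0 powR1.
have rec m : derive1n m.+1 f 0 = 2 * (m%:R + lam) * x * derive1n m f 0
       - m%:R * (m%:R - 1 + 2 * lam) * derive1n m.-1 f 0.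
  by have [_ _] := derive1n_generating m Q0_gt0; rewrite Q0 mul1r subr0.
suff : gegenbauer lam n x = (P n).[x] /\ gegenbauer lam n.+1 x = (P n.+1).[x] by case.
rewrite /gegenbauer -/f; elim: n => [|n [ih ihS]].
  rewrite rec derive1n0 f0 gegen_poly0 gegen_poly1 fact0 factS fact0 -polyC_natr !hornerE.
  by split; field.
split=> //; apply: (@mulfI _ n.+2%:R); first by rewrite pnatr_eq0.
rewrite gegen_poly_recE -ih -ihS rec !factS !natrM.
by field; rewrite nat1r -natrD !pnatr_eq0 -lt0n fact_gt0.
Qed.

End GeneratingFunction.

End GegenbauerPolynomials.

(** * Integrals against (1 - x^2)^(lam - 1) *)

Section JacobiWeight.
Context {R : realType}.
Let mu : {measure set _ -> \bar R} := @lebesgue_measure R.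

(** The interval (-1, 1) is exhausted by the [- cos y, cos y] with y = 1/(n+2):
    the arcsine of cos y is pi/2 - y, which makes its limits at both ends
    explicit. *)
Let y (n : nat) : R := n.+2%:R^-1.
Let v n : R := cos (y n).
Let u n : R := - v n.

Let y_gt0 n : 0 < y n. Proof. by rewrite invr_gt0. Qed.

Let y_lt1 n : y n < 1. Proof. by rewrite invf_lt1// ltr1n. Qed.

Let cvg_y : y n @[n --> \oo] --> (0 : R).
Proof.
have := @cvg_harmonic R; rewrite -(cvg_shiftn 1)/=.
by under eq_fun do rewrite addn1.
Qed.

Let y_pi n : y n \in `[0, pi]%R.
Proof.
rewrite in_itv/= ltW//= (le_trans (ltW (y_lt1 n)))//.
by rewrite (le_trans _ (@pi_ge2 R))// ler1n.
Qed.

Let v_gt0 n : 0 < v n.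
Proof.
apply: cos_gt0_pihalf; rewrite (lt_le_trans (y_lt1 n) (@pihalf_ge1 R)) andbT.
by rewrite (@lt_trans _ _ 0)// oppr_lt0 (lt_le_trans ltr01 (@pihalf_ge1 R)).
Qed.

Let v_lt1 n : v n < 1.
Proof.
rewrite /v -[X in _ < X]cos0 ltr_cos//.
by rewrite in_itv/= lexx pi_ge0.
Qed.

Let ltuv n : u n < v n.
Proof. by rewrite (@lt_trans _ _ 0)// oppr_lt0. Qed.

Let ndv : nondecreasing_seq v.
Proof.
move=> m n mn; rewrite leNgt /v ltr_cos// -leNgt lef_pV2 ?posrE// ler_nat.
by rewrite !ltnS.
Qed.

Let niu : nonincreasing_seq u.
Proof. by move=> m n mn; rewrite lerN2 ndv. Qed.

Let cvg_v : v n @[n --> \oo] --> (1 : R).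
Proof.
rewrite -[X in _ --> X](@cos0 R); apply: continuous_cvg cvg_y.
exact: continuous_cos.
Qed.

Let cvg_u : u n @[n --> \oo] --> (- 1 : R).
Proof. exact: cvgN cvg_v. Qed.

Let itvN11_bigcup : `](-1)%R, 1%R[%classic = \bigcup_n `[u n, v n]%classic :> set R.
Proof.
apply/seteqP; split => [x|x [n _]] /=; rewrite !in_itv/=; last first.
  move=> /andP[ux xv]; rewrite (le_lt_trans xv)//.
  by rewrite (lt_le_trans _ ux)// ltrN2.
rewrite -ltr_norml => x1.
have [N _ /(_ N (leqnn N)) xv] := cvgr_gt _ cvg_v _ x1.
by exists N => //=; rewrite in_itv/= -ler_norml ltW.
Qed.

Section FTCN11.
Variables (f F : R -> R) (la lb : R).
Hypothesis dF : forall x : R, -1 < x < 1 -> is_derive x 1 F (f x).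
Hypothesis cf : forall x : R, -1 < x < 1 -> {for x, continuous f}.
Hypothesis Fu : F (u n) @[n --> \oo] --> la.
Hypothesis Fv : F (v n) @[n --> \oo] --> lb.

Let inN11 x : (\bigcup_n `[u n, v n]%classic) x -> -1 < x < 1.
Proof. by rewrite -itvN11_bigcup /= in_itv. Qed.

Let dF' x (xD : (\bigcup_n `[u n, v n]%classic) x) := dF (inN11 xD).
Let cf' x (xD : (\bigcup_n `[u n, v n]%classic) x) := cf (inN11 xD).

Lemma ge0_FTCN11 : (forall x : R, -1 < x < 1 -> 0 <= f x) ->
  (\int[mu]_(x in `](-1)%R, 1%R[) (f x)%:E = (lb - la)%:E)%E.
Proof.
move=> f0; rewrite itvN11_bigcup.
by apply: (ge0_improper_FTC ltuv niu ndv dF' cf' Fu Fv) => x /inN11 /f0.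
Qed.

Lemma integrableN11 : (forall x : R, -1 < x < 1 -> 0 <= f x) ->
  mu.-integrable `](-1)%R, 1%R[ (EFin \o f).
Proof.
move=> f0; rewrite itvN11_bigcup.
by apply: (integrable_improper ltuv niu ndv dF' cf' Fu Fv) => x /inN11 /f0.
Qed.

Lemma integrable_FTCN11 : mu.-integrable `](-1)%R, 1%R[ (EFin \o f) ->
  (\int[mu]_(x in `](-1)%R, 1%R[) (f x)%:E = (lb - la)%:E)%E.
Proof.
rewrite itvN11_bigcup => fi.
exact: (integrable_improper_FTC ltuv niu ndv dF' cf' Fu Fv).
Qed.

End FTCN11.

Lemma oneBsqr_gt0 (x : R) : -1 < x < 1 -> 0 < 1 - x ^+ 2.
Proof. by move=> /andP[x0 x1]; nra. Qed.

Definition jacobi_weight (lam x : R) : R := (1 - x ^+ 2) `^ (lam - 1).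

Local Notation w := jacobi_weight.

Lemma is_derive_oneBsqr (x : R) : is_derive x 1 (fun x : R => 1 - x ^+ 2) (- 2 * x).
Proof.
have dq : is_derive x 1 (fun t : R => t ^+ 2) (2 * x).
  by apply: is_derive_eq (is_deriveX 2 (is_derive_id x 1)) _; rewrite /GRing.scale/= mulr1 expr1.
apply: is_derive_eq (is_deriveB (is_derive_cst (1 : R) x 1) dq) _.
by ring.
Qed.

Lemma is_derive_powR_oneBsqr (lam x : R) : -1 < x < 1 ->
  is_derive x 1 (fun x : R => (1 - x ^+ 2) `^ lam) (- 2 * lam * x * w lam x).
Proof.
move=> x11; have q0 := oneBsqr_gt0 x11.
have H := @is_derive1_comp _ (fun x => x `^ lam) (fun x : R => 1 - x ^+ 2) _ _ _
  (is_derive1_powR lam q0) (is_derive_oneBsqr x).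
by apply: is_derive_eq H _; rewrite /jacobi_weight; ring.
Qed.

Lemma continuous_jacobi_weight (lam x : R) : -1 < x < 1 -> {for x, continuous (w lam)}.
Proof. by move=> x11; exact: is_derive_continuous (is_derive_powR_oneBsqr (lam - 1) x11). Qed.

Let asin_v n : asin (v n) = pi / 2 - y n.
Proof.
have -> : v n = sin (pi / 2 - y n).
  by rewrite sinB sin_pihalf cos_pihalf mul1r mul0r subr0.
rewrite sinK// in_itv/= gerBl (ltW (y_gt0 n)) andbT.
have := y_lt1 n; have := @pihalf_ge1 R; lra.
Qed.

Let asin_u n : asin (u n) = - (pi / 2 - y n).
Proof.
have -> : u n = sin (- (pi / 2 - y n)).
  by rewrite sinN sinB sin_pihalf cos_pihalf mul1r mul0r subr0.
rewrite sinK// in_itv/= lerN2 gerBl (ltW (y_gt0 n))/=.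
have := y_lt1 n; have := @pihalf_ge1 R; lra.
Qed.

Let cvg_pihalfB_y : pi / 2 - y n @[n --> \oo] --> (pi / 2 : R).
Proof.
by rewrite -[X in _ --> X]subr0; apply: cvgB => //; exact: cvg_cst.
Qed.

Lemma jacobi_weight_half (x : R) : -1 < x < 1 -> w (1 / 2) x = (Num.sqrt (1 - x ^+ 2))^-1.
Proof.
move=> x11; rewrite /jacobi_weight -powR12_sqrt ?ltW ?oneBsqr_gt0// -powRN.
by congr powR; lra.
Qed.

Let dasin (x : R) : -1 < x < 1 -> is_derive x 1 asin (w (1 / 2) x).
Proof. by move=> x11; rewrite jacobi_weight_half//; exact: is_derive1_asin. Qed.

Let cvg_asin_v : asin (v n) @[n --> \oo] --> (pi / 2 : R).
Proof. by under eq_fun do rewrite asin_v. Qed.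

Let cvg_asin_u : asin (u n) @[n --> \oo] --> (- (pi / 2) : R).
Proof. by under eq_fun do rewrite asin_u; exact: cvgN. Qed.

Lemma jacobi_weight_ge0 lam (x : R) : 0 <= w lam x.
Proof. exact: powR_ge0. Qed.

Lemma integral_jacobi_weight_half :
  (\int[mu]_(x in `](-1)%R, 1%R[) (w (1 / 2) x)%:E = pi%:E)%E.
Proof.
rewrite (ge0_FTCN11 dasin _ cvg_asin_u cvg_asin_v); first by congr EFin; lra.
- by move=> x; exact: continuous_jacobi_weight.
- by move=> x _; exact: jacobi_weight_ge0.
Qed.

Lemma measurable_jacobi_weight lam D : measurable_fun D (w lam).
Proof.
apply: measurable_funTS; apply: (measurableT_comp (measurable_powR (lam - 1))).
by apply: measurable_funB => //; exact: measurable_funX.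
Qed.

(** For lam >= 1/2 the weight is at most the one for 1/2, whose antiderivative
    is the arcsine. *)
Lemma integrable_jacobi_weight lam : 1 / 2 <= lam ->
  mu.-integrable `](-1)%R, 1%R[ (EFin \o w lam).
Proof.
move=> lam2; have ih : mu.-integrable `](-1)%R, 1%R[ (EFin \o w (1 / 2)).
  apply: (integrableN11 dasin _ cvg_asin_u cvg_asin_v).
  - by move=> x; exact: continuous_jacobi_weight.
  - by move=> x _; exact: jacobi_weight_ge0.
apply: le_integrable ih => //.
  by apply/measurable_EFinP; exact: measurable_jacobi_weight.
move=> x /=; rewrite in_itv/= => x11.
rewrite lee_fin !ger0_norm ?jacobi_weight_ge0//.
by rewrite ger_powR ?oneBsqr_gt0//= ?gerBl ?sqr_ge0// lerB.
Qed.

(** On (-1, 1) a polynomial is bounded by the sum of its absolute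
    coefficients. *)
Lemma integrable_poly_jacobi lam (p : {poly R}) : 1 / 2 <= lam ->
  mu.-integrable `](-1)%R, 1%R[ (EFin \o (fun x => p.[x] * w lam x)).
Proof.
move=> lam2; pose M := \sum_(i < size p) `|p`_i|.
have := integrableZl _ M (integrable_jacobi_weight lam2).
move=> /(_ (measurable_itv _)); apply: le_integrable => //.
  apply/measurable_EFinP; apply: measurable_funM; last exact: measurable_jacobi_weight.
  by apply: measurable_funTS; apply: continuous_measurable_fun; exact: continuous_horner.
move=> x /=; rewrite in_itv/= => x11.
rewrite lee_fin !normrM ler_wpM2r// [leRHS]ger0_norm ?sumr_ge0//.
rewrite horner_coef (le_trans (ler_norm_sum _ _ _))// ler_sum// => i _.
rewrite normrM ler_piMr// normrX exprn_ile1//.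
by rewrite ltW// ltr_norml.
Qed.

Definition jacobi_integral lam (p : {poly R}) : R :=
  \int[mu]_(x in `](-1), 1[) (p.[x] * w lam x).

Local Notation I := jacobi_integral.

Section Jacobi.
Variable lam : R.
Hypothesis lam2 : 1 / 2 <= lam.

Lemma jacobi_integralE p :
  (\int[mu]_(x in `](-1)%R, 1%R[) (p.[x] * w lam x)%:E = (I lam p)%:E)%E.
Proof.
by rewrite fineK//; apply: integrable_fin_num => //; exact: integrable_poly_jacobi.
Qed.

Lemma jacobi_integralB p q : I lam (p - q) = I lam p - I lam q.
Proof.
rewrite /jacobi_integral -RintegralB//; try exact: integrable_poly_jacobi.
by apply: eq_Rintegral => x _; rewrite !hornerE mulrBl.
Qed.

Lemma jacobi_integralZ c p : I lam (c%:P * p) = c * I lam p.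
Proof.
rewrite /jacobi_integral -RintegralZl//; try exact: integrable_poly_jacobi.
by apply: eq_Rintegral => x _; rewrite hornerM hornerC mulrA.
Qed.

Let cvg_powR_v : (1 - v n ^+ 2) `^ lam @[n --> \oo] --> (0 : R).
Proof.
have lam0 : 0 < lam by apply: lt_le_trans lam2; lra.
move/cvg_at_rightP : (powR_cvg0 lam0); apply; split.
  move=> n; apply: oneBsqr_gt0; rewrite v_lt1 andbT.
  by rewrite (lt_trans _ (v_gt0 n))// oppr_lt0.
have := cvgM cvg_v cvg_v; rewrite mulr1 => v2.
rewrite -(subrr 1); apply: cvgB; first exact: cvg_cst.
exact: v2.
Qed.

(** The integrand is the derivative of (1 - x^2)^lam p, which tends to 0 at both
    ends. *)
Lemma jacobi_integral_by_parts p :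
  I lam ((1 - 'X^2) * p^`() - (2 * lam)%:P * ('X * p)) = 0.
Proof.
have lam0 : 0 < lam by apply: lt_le_trans lam2; lra.
apply: EFin_inj; rewrite -jacobi_integralE.
rewrite (_ : 0%:E = (0 - 0)%:E)%E; last by rewrite subrr.
pose F x := p.[x] * (1 - x ^+ 2) `^ lam.
have dF (x : R) : -1 < x < 1 -> is_derive x 1 F
    (((1 - 'X^2) * p^`() - (2 * lam)%:P * ('X * p)).[x] * w lam x).
  move=> x11.
  apply: is_derive_eq (is_deriveM (is_derive_poly p x) (is_derive_powR_oneBsqr lam x11)) _.
  have -> : (1 - x ^+ 2) `^ lam = (1 - x ^+ 2) * w lam x.
    by rewrite mulr_powRB1// ltW// oneBsqr_gt0.
  by rewrite /GRing.scale/= !hornerE /=; ring.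
apply: (integrable_FTCN11 dF); last exact: integrable_poly_jacobi.
- move=> x x11; apply: cvgM; first exact: continuous_horner.
  exact: continuous_jacobi_weight.
- rewrite -[X in _ --> X](mulr0 p.[-1]); apply: cvgM.
    by apply: continuous_cvg cvg_u; exact: continuous_horner.
  by under eq_fun do rewrite sqrrN; exact: cvg_powR_v.
- rewrite -[X in _ --> X](mulr0 p.[1]); apply: cvgM.
    by apply: continuous_cvg cvg_v; exact: continuous_horner.
  exact: cvg_powR_v.
Qed.

(** Integration by parts for p = x, where (1 - x^2) - 2 lam x^2 is
    (1 + 2 lam) (1 - x^2) - 2 lam. *)
Lemma jacobi_integral_oneBX2 :
  (1 + 2 * lam) * I lam (1 - 'X^2) = 2 * lam * I lam 1.
Proof.
have := jacobi_integral_by_parts 'X.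
rewrite derivX.
have -> : (1 - 'X^2) * 1 - (2 * lam)%:P * ('X * 'X) =
    (1 + 2 * lam)%:P * (1 - 'X^2) - (2 * lam)%:P * 1 :> {poly R}.
  by rewrite [(1 + _)%:P]polyCD; ring.
by rewrite jacobi_integralB !jacobi_integralZ => /eqP; rewrite subr_eq0 => /eqP.
Qed.

Local Notation P := (gegen_poly lam).

(** Integration by parts for p = C_(n+1), with (1 - x^2) C_(n+1)' expressed by
    [gegen_poly_deriv]. *)
Lemma gegen_moments n : (n.+1%:R + 2 * lam) * I lam ('X * P n.+1) =
  (n%:R + 2 * lam) * I lam (P n).
Proof.
have := jacobi_integral_by_parts (P n.+1); rewrite gegen_poly_deriv.
have -> : (n%:R + 2 * lam%:P) * P n - n.+1%:R * 'X * P n.+1 -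
    (2 * lam)%:P * ('X * P n.+1) =
    (n%:R + 2 * lam)%:P * P n - (n.+1%:R + 2 * lam)%:P * ('X * P n.+1).
  by rewrite !polyCD !polyC_natr polyCM polyC_natr; ring.
by rewrite jacobi_integralB !jacobi_integralZ => /eqP; rewrite subr_eq0 => /eqP.
Qed.

Lemma gegen_integral_rec n :
  n.+2%:R * (n.+1%:R + 2 * lam) * I lam (P n.+2) =
  n.+1%:R * (n%:R + 2 * lam) * I lam (P n).
Proof.
have H : n.+2%:R * I lam (P n.+2) =
    2 * (n.+1%:R + lam) * I lam ('X * P n.+1) - (n%:R + 2 * lam) * I lam (P n).
  rewrite -!jacobi_integralZ -jacobi_integralB polyC_natr gegen_poly_rec.
  congr jacobi_integral.
  by rewrite polyCM polyC_natr polyCD polyC_natr [(_ + 2 * _)%:P]polyCD polyC_natr polyCM polyC_natr; ring.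
rewrite mulrAC H mulrBl -[_ * _ * (_ + _)]mulrA [I _ _ * (_ + _)]mulrC gegen_moments.
by rewrite -[n.+1%:R]natr1; ring.
Qed.

(** The recurrence propagates I_1 = 2 lam J_0 = 0; integration by parts for
    p = 1 says that J_0 = 0. *)
Lemma gegen_integral_odd k : I lam (P k.*2.+1) = 0.
Proof.
have lam0 : 0 < lam by apply: lt_le_trans lam2; lra.
elim: k => [|k ih].
  have := jacobi_integral_by_parts 1.
  rewrite -[1]/(1%:P) derivC mulr0 sub0r mulr1.
  have -> : - ((2 * lam)%:P * 'X) = (- 1)%:P * P 1.
    by rewrite gegen_poly1 polyCM polyC_natr polyCN; ring.
  by rewrite jacobi_integralZ mulN1r => /eqP; rewrite oppr_eq0 => /eqP.
have := gegen_integral_rec k.*2.+1; rewrite ih mulr0 => /eqP.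
rewrite mulf_eq0 => /orP[|/eqP//]; rewrite mulf_eq0 pnatr_eq0/= => /eqP.
have := ler0n R k.*2.+1.+1; lra.
Qed.

Lemma gegen_moment_even k : I lam ('X * P k.*2) = 0.
Proof.
have lam0 : 0 < lam by apply: lt_le_trans lam2; lra.
case: k => [|k].
  have := gegen_integral_odd 0; rewrite double0 gegen_poly1 gegen_poly0 mulr1.
  have -> : 2 * lam%:P * 'X = (2 * lam)%:P * 'X by rewrite polyCM polyC_natr.
  rewrite jacobi_integralZ => /eqP; rewrite mulf_eq0 => /orP[/eqP|/eqP//]; lra.
have := gegen_moments k.*2.+1; rewrite gegen_integral_odd mulr0 => /eqP.
rewrite mulf_eq0 => /orP[/eqP|/eqP//].
have := ler0n R k.*2.+1.+1; lra.
Qed.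

End Jacobi.
End JacobiWeight.

(** * The beta integral and the reduction of the coefficients *)

Section BetaIntegral.
Context {R : realType}.
Let mu : {measure set _ -> \bar R} := @lebesgue_measure R.

Local Notation I := jacobi_integral.
Local Notation w := jacobi_weight.

(** The weight for lam + 1 is 1 - x^2 times the weight for lam. *)
Lemma jacobi_integral_add1 (lam : R) :
  1 / 2 <= lam -> (1 + 2 * lam) * I (lam + 1) 1 = 2 * lam * I lam 1.
Proof.
move=> lam2; rewrite -(jacobi_integral_oneBX2 lam2); congr (_ * _).
apply: eq_Rintegral => x; rewrite inE/= in_itv/= => /oneBsqr_gt0 q0.
rewrite /jacobi_weight addrK -(mulr_powRB1 (ltW q0)); last by lra.
by rewrite !hornerE/= mul1r.
Qed.

(** The evaluation B(1/2, lam) = Gamma(1/2) Gamma(lam) / Gamma(lam + 1/2) for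
    lam = (n + 1) / 2.  Steps of two in n, that is of one in lam, multiply both
    sides by the same factor; lam = 1/2 gives pi and lam = 1 gives 2. *)
Lemma jacobi_integral_beta n :
  I (n.+1%:R / 2) 1 * Gamma (n.+2%:R / 2) =
  Gamma (1 / 2) * Gamma (n.+1%:R / 2) :> R.
Proof.
have d2 : 2 / 2 = 1 :> R by lra.
elim/ltn_ind: n => -[_|[_|n ih]].
- rewrite d2 Gamma1 mulr1 Gamma_half -expr2 sqr_sqrtr; last exact: pi_ge0.
  apply: EFin_inj; rewrite -jacobi_integralE; last exact: lexx.
  rewrite -integral_jacobi_weight_half.
  by apply: eq_integral => x _; rewrite hornerC mul1r.
- have -> : 3 / 2 = 1 / 2 + 1 :> R by lra.
  have h0 : 0 < 1 / 2 :> R by lra.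
  rewrite d2 Gamma1 (Gamma_add1 h0).
  have -> : I 1 1 = 2 :> R.
    rewrite /jacobi_integral.
    under eq_Rintegral do rewrite /jacobi_weight subrr powRr0 hornerC mulr1.
    rewrite Rintegral_cst//= lebesgue_measure_itv/= lte_fin.
    by rewrite ifT ?mul1r/=; lra.
  by rewrite mulrA mulrC; congr (_ * _); lra.
have E : n.+3%:R / 2 = n.+1%:R / 2 + 1 :> R by rewrite -addn2 natrD; field.
have E' : n.+4%:R / 2 = n.+2%:R / 2 + 1 :> R by rewrite -[n.+4]addn2 natrD; field.
have z1 : 0 < n.+1%:R / 2 :> R by rewrite divr_gt0.
have z2 : 0 < n.+2%:R / 2 :> R by rewrite divr_gt0.
have n0 := ler0n R n.
have lam2 : 1 / 2 <= n.+1%:R / 2 :> R by rewrite -[n.+1%:R]natr1; lra.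
rewrite E E' (Gamma_add1 z1) (Gamma_add1 z2).
move: (jacobi_integral_add1 lam2) (ih n (leqnSn _)).
move: (I (n.+1%:R / 2 + 1) 1) (I (n.+1%:R / 2) 1) => J J'.
move: (Gamma (1 / 2)) (Gamma (n.+1%:R / 2)) (Gamma (n.+2%:R / 2)) => G0 G1 G2 HJ HG.
have {}HJ : n.+2%:R * J = n.+1%:R * J' by move: HJ; rewrite -[n.+2%:R]natr1; lra.
transitivity (n.+2%:R * J * G2 / 2); first by field.
by rewrite HJ -[_ * G2]mulrA HG; field.
Qed.

(** With c = cos (t / 2) and s = sin (t / 2), c / s + a s / c is
    (c^2 + a s^2) / (s c), where c^2 = (1 + x) / 2, s^2 = (1 - x) / 2 and
    2 s c = sin t. *)
Lemma psi_acosE (a x : R) : -1 < x < 1 ->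
  psi a (acos x) = ((1 + a) + (1 - a) * x) / Num.sqrt (1 - x ^+ 2).
Proof.
move=> /andP[x1 x1']; set t := acos x.
have t0 : 0 < t by rewrite acos_gt0// (ltW x1).
have tpi : t < pi by rewrite acos_ltpi// x1 ltW.
have s0 : 0 < sin (t / 2).
  by apply: sin_gt0_pihalf; rewrite divr_gt0//= ltr_pM2r.
have c0 : 0 < cos (t / 2).
  apply: cos_gt0_pihalf; rewrite ltr_pM2r// tpi andbT.
  by rewrite (@lt_trans _ _ 0) ?oppr_lt0 ?divr_gt0 ?pi_gt0.
have tt : t = t / 2 *+ 2 by rewrite -mulr_natr divfK.
have cosE : x = cos (t / 2) ^+ 2 *+ 2 - 1.
  by rewrite -cos_mulr2n -tt acosK// in_itv/= !ltW.
have sinE : Num.sqrt (1 - x ^+ 2) = (cos (t / 2) * sin (t / 2)) *+ 2.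
  by rewrite -sin_mulr2n -tt sin_acos// !ltW.
rewrite sinE /psi /tan; move: cosE (cos2Dsin2 (t / 2)).
set c := cos _ in c0 *; set s := sin _ in s0 *.
move=> -> cs.
have -> : 1 + a + (1 - a) * (c ^+ 2 *+ 2 - 1) = 2 * (c ^+ 2 + a * s ^+ 2).
  have -> : s ^+ 2 = 1 - c ^+ 2 by rewrite -cs; ring.
  by ring.
by field; rewrite !gt_eqF.
Qed.

(** The square root in the denominator of psi lowers the exponent of
    1 - x^2 from q / 2 - 1 to lam - 1. *)
Lemma gegen_coefE (a : R) (k q : nat) : (2 <= q)%N ->
  gegen_coef k q (psi a) =
  ((gegen_c R k q)^-1 *
   ((1 + a) * I (gegen_index R q) (gegen_poly (gegen_index R q) k) +
    (1 - a) * I (gegen_index R q) ('X * gegen_poly (gegen_index R q) k)))%:E.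
Proof.
move=> q2; set lam := gegen_index R q; set p := gegen_poly lam k.
have lam2 : 1 / 2 <= lam.
  have : 2 <= q%:R :> R by rewrite ler_nat.
  by rewrite /lam /gegen_index; lra.
rewrite /gegen_coef EFinM; congr (_ * _)%E.
have -> : (1 + a) * I lam p + (1 - a) * I lam ('X * p) =
    I lam ((1 + a)%:P * p - (a - 1)%:P * ('X * p)).
  rewrite (jacobi_integralB lam2) !(jacobi_integralZ lam2); ring.
rewrite -(jacobi_integralE lam2).
apply: eq_integral => x; rewrite inE/= in_itv/= => x11.
have q0 := oneBsqr_gt0 x11.
congr EFin; rewrite psi_acosE// gegenbauerE -/lam -/p.
have -> : (1 - x ^+ 2) `^ (q%:R / 2 - 1) = w lam x * Num.sqrt (1 - x ^+ 2).
  rewrite /jacobi_weight -powR12_sqrt ?ltW// -powRD; last by rewrite (gt_eqF q0) implybT.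
  by congr powR; rewrite /lam /gegen_index; lra.
rewrite !hornerE/=; field.
by rewrite gt_eqF// sqrtr_gt0.
Qed.

End BetaIntegral.

(** * Closed forms *)

Section ClosedForms.
Context {R : realType}.

Local Notation I := jacobi_integral.

(** Passing from k to k + 1 multiplies both sides by
    (k + 1/2) (k + lam); the case k = 0 is the beta integral. *)
Lemma gegen_integral_even (n k : nat) (lam : R) : lam = n.+1%:R / 2 ->
  I lam (gegen_poly lam k.*2) * k`!%:R * Gamma (k%:R + lam + 1 / 2) =
  Gamma (k%:R + 1 / 2) * Gamma (k%:R + lam).
Proof.
move=> lamE.
have lam2 : 1 / 2 <= lam by rewrite lamE ler_pM2r// ler1n.
have lam0 : 0 < lam by rewrite lamE divr_gt0.
elim: k => [|k ih].
  rewrite double0 gegen_poly0 fact0 mulr1 !add0r lamE -jacobi_integral_beta.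
  by congr (_ * Gamma _); rewrite -[n.+2%:R]natr1; lra.
have k0 := ler0n R k.
have k2 : k.*2%:R = 2 * k%:R :> R by rewrite -mul2n natrM.
have H := gegen_integral_rec lam2 k.*2.
have {}H : (k%:R + 1) * (k%:R + lam + 1 / 2) * I lam (gegen_poly lam k.*2.+2) =
    (k%:R + 1 / 2) * (k%:R + lam) * I lam (gegen_poly lam k.*2).
  move: H; rewrite -[k.*2.+2%:R]natr1 -[k.*2.+1%:R]natr1 k2 => H.
  (* the factor 4 clears the halves *)
  apply: (@mulfI _ (4 : R)); first by rewrite pnatr_eq0.
  by transitivity ((2 * k%:R + 1 + 1) * (2 * k%:R + 1 + 2 * lam) *
    I lam (gegen_poly lam k.*2.+2)); [by field|rewrite H; by field].
have z3 : 0 < k%:R + lam by rewrite ltr_wpDl.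
have z2 : 0 < k%:R + 1 / 2 :> R by rewrite ltr_wpDl ?divr_gt0.
have z1 : 0 < k%:R + lam + 1 / 2 by rewrite addr_gt0 ?divr_gt0.
rewrite doubleS factS natrM -[k.+1%:R]natr1.
have -> : k%:R + 1 + lam + 1 / 2 = k%:R + lam + 1 / 2 + 1 by ring.
have -> : k%:R + 1 + 1 / 2 = k%:R + 1 / 2 + 1 :> R by ring.
have -> : k%:R + 1 + lam = k%:R + lam + 1 by ring.
rewrite (Gamma_add1 z1) (Gamma_add1 z2) (Gamma_add1 z3).
move: (Gamma (k%:R + lam + 1 / 2)) (Gamma (k%:R + 1 / 2)) (Gamma (k%:R + lam)) ih => G1 G2 G3.
move: (I lam (gegen_poly lam k.*2.+2)) (I lam (gegen_poly lam k.*2)) H => J J' H ih.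
transitivity ((k%:R + 1) * (k%:R + lam + 1 / 2) * J * k`!%:R * G1); first by ring.
rewrite H; transitivity ((k%:R + 1 / 2) * (k%:R + lam) * (J' * k`!%:R * G1)).
  by ring.
by rewrite ih; ring.
Qed.

(** C_(2k)(1) = (2 lam)_(2k) / (2k)!, with both Pochhammer symbols split into
    two by the duplication (2 z)_(2k) = 4^k (z)_k (z + 1/2)_k so that the
    factors cancel against those of [gegen_integral_even]. *)
Lemma gegen_poly_at1_even (lam : R) (k : nat) : 0 < lam ->
  (gegen_poly lam k.*2).[1] * k`!%:R * Gamma (k%:R + 1 / 2) *
    (Gamma lam * Gamma (lam + 1 / 2)) =
  Gamma (1 / 2) * Gamma (k%:R + lam) * Gamma (k%:R + lam + 1 / 2).
Proof.
move=> lam0; elim: k => [|k ih].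
  by rewrite double0 gegen_poly0 fact0 hornerC mulr1 [1 * Gamma _]mul1r !add0r mulrA.
have k0 := ler0n R k.
have k2 : k.*2%:R = 2 * k%:R :> R by rewrite -mul2n natrM.
have H1 := gegen_poly_at1 lam k.*2.
have H2 := gegen_poly_at1 lam k.*2.+1.
have H : (k%:R + 1) * (k%:R + 1 / 2) * (gegen_poly lam k.*2.+2).[1] =
    (k%:R + lam) * (k%:R + lam + 1 / 2) * (gegen_poly lam k.*2).[1].
  move: H1 H2; rewrite -[k.*2.+2%:R]natr1 -[k.*2.+1%:R]natr1 k2 => H1 H2.
  (* the factor 4 clears the halves *)
  apply: (@mulfI _ (4 : R)); first by rewrite pnatr_eq0.
  transitivity ((2 * k%:R + 1) * ((2 * k%:R + 1 + 1) * (gegen_poly lam k.*2.+2).[1])).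
    by field.
  rewrite H2 mulrCA H1; by field.
have z3 : 0 < k%:R + lam by rewrite ltr_wpDl.
have z2 : 0 < k%:R + 1 / 2 :> R by rewrite ltr_wpDl ?divr_gt0.
have z1 : 0 < k%:R + lam + 1 / 2 by rewrite addr_gt0 ?divr_gt0.
rewrite doubleS factS natrM -[k.+1%:R]natr1.
have -> : k%:R + 1 + lam + 1 / 2 = k%:R + lam + 1 / 2 + 1 by ring.
have -> : k%:R + 1 + 1 / 2 = k%:R + 1 / 2 + 1 :> R by ring.
have -> : k%:R + 1 + lam = k%:R + lam + 1 by ring.
rewrite (Gamma_add1 z1) (Gamma_add1 z2) (Gamma_add1 z3).
move: (Gamma lam) (Gamma (lam + 1 / 2)) (Gamma (1 / 2)) ih => G4 G5 G6.
move: (Gamma (k%:R + lam + 1 / 2)) (Gamma (k%:R + 1 / 2)) (Gamma (k%:R + lam)) => G1 G2 G3.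
move: (gegen_poly lam k.*2.+2).[1] (gegen_poly lam k.*2).[1] H => p p' H ih.
transitivity ((k%:R + 1) * (k%:R + 1 / 2) * p * k`!%:R * G2 * (G4 * G5)); first by ring.
rewrite H; transitivity ((k%:R + lam) * (k%:R + lam + 1 / 2) *
  (p' * k`!%:R * G2 * (G4 * G5))); first by ring.
by rewrite ih; ring.
Qed.

(** The quotient of the two sphere areas is
    sqrt pi Gamma(lam + 1/2) / Gamma(lam + 1). *)
Lemma gegen_cE (n K : nat) (lam : R) : lam = n.+1%:R / 2 ->
  gegen_c R K n.+2 = Num.sqrt pi * Gamma (lam + 1 / 2) / Gamma lam *
    (gegen_poly lam K).[1] / (lam + K%:R).
Proof.
move=> lamE.
have lam0 : 0 < lam by rewrite lamE divr_gt0.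
have q1 : n.+2%:R - 1 = 2 * lam by rewrite lamE -[n.+2%:R]natr1; lra.
have K0 := ler0n R K.
rewrite /gegen_c /gegen_d gegenbauerE.
have -> : gegen_index R n.+2 = lam by rewrite /gegen_index q1 mulrC mulKf.
rewrite q1 /omega.
have -> : (n.+2%:R + 1) / 2 = lam + 1 by lra.
have -> : (n.+2.-1%:R + 1) / 2 = lam + 1 / 2 by rewrite /= lamE -[n.+1%:R]natr1; lra.
have -> : pi `^ (lam + 1) = pi `^ (lam + 1 / 2) * Num.sqrt pi.
  rewrite -powR12_sqrt ?pi_ge0// -powRD; last by rewrite (gt_eqF (pi_gt0 R)) implybT.
  by congr powR; lra.
rewrite Gamma_add1//.
have G1 : Gamma lam != 0 by rewrite lamE gt_eqF// Gamma_halfn_gt0.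
have G2 : Gamma (lam + 1 / 2) != 0.
  have -> : lam + 1 / 2 = n.+2%:R / 2 by lra.
  by rewrite gt_eqF// Gamma_halfn_gt0.
have P1 : pi `^ (lam + 1 / 2) != 0 by rewrite gt_eqF// powR_gt0// pi_gt0.
move: (Gamma lam) (Gamma (lam + 1 / 2)) (pi `^ (lam + 1 / 2)) G1 G2 P1 => A B C A0 B0 C0.
move: (_.[1]) (Num.sqrt pi) => p s.
by field; rewrite A0 B0 C0 (gt_eqF lam0) gt_eqF// ltr_pwDl.
Qed.

Lemma alphaE (n k : nat) (lam : R) : lam = n.+1%:R / 2 ->
  alpha R k n.+2 = Gamma (k%:R + 1 / 2) ^+ 2 * Gamma lam ^+ 2 /
    (2 * pi * Gamma (k%:R + lam + 1 / 2) ^+ 2).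
Proof.
move=> lamE; rewrite /alpha.
have -> : (n.+2%:R - 1) / 2 = lam by rewrite lamE -[n.+2%:R]natr1; lra.
have -> : k%:R + n.+2%:R / 2 = k%:R + lam + 1 / 2 by rewrite lamE -[n.+2%:R]natr1; lra.
by [].
Qed.

Lemma Gamma_halfn_neq0 (z : R) n : z = n.+1%:R / 2 -> Gamma z != 0.
Proof. by move=> ->; rewrite gt_eqF// Gamma_halfn_gt0. Qed.

Lemma gegen_ratio_even (n k : nat) (lam : R) : lam = n.+1%:R / 2 ->
  (gegen_c R k.*2 n.+2)^-1 * I lam (gegen_poly lam k.*2) =
  alpha R k n.+2 * (2 * (2 * k%:R + lam)).
Proof.
move=> lamE; have lam0 : 0 < lam by rewrite lamE divr_gt0.
have k0 := ler0n R k.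
have k2 : k.*2%:R = 2 * k%:R :> R by rewrite -mul2n natrM.
have f0 : k`!%:R != 0 :> R by rewrite pnatr_eq0 -lt0n fact_gt0.
have A0 : Gamma (k%:R + 1 / 2) != 0 :> R.
  by apply: (@Gamma_halfn_neq0 _ k.*2); rewrite -[k.*2.+1%:R]natr1 k2; field.
have B0 : Gamma lam != 0 by exact: Gamma_halfn_neq0 lamE.
have C0 : Gamma (lam + 1 / 2) != 0.
  by apply: (@Gamma_halfn_neq0 _ n.+1); rewrite lamE -[n.+2%:R]natr1; field.
have D0 : Gamma (k%:R + lam) != 0.
  by apply: (@Gamma_halfn_neq0 _ (k.*2 + n)); rewrite lamE -addnS natrD k2; field.
have E0 : Gamma (k%:R + lam + 1 / 2) != 0.
  by apply: (@Gamma_halfn_neq0 _ (k.*2 + n.+1)); rewrite lamE -addnS natrD k2 -[n.+2%:R]natr1; field.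
have s0 : Num.sqrt pi != 0 :> R by rewrite gt_eqF// sqrtr_gt0 pi_gt0.
have s2 : 2 * pi = 2 * Num.sqrt pi ^+ 2 :> R by rewrite sqr_sqrtr// pi_ge0.
have L0 : lam + 2 * k%:R != 0 by rewrite gt_eqF// ltr_pwDl// mulr_ge0.
have E1 := gegen_integral_even k lamE.
have E2 := gegen_poly_at1_even k lam0; rewrite Gamma_half in E2.
rewrite (gegen_cE _ lamE) (alphaE _ lamE) k2 s2.
move: E1 E2 A0 B0 C0 D0 E0 f0 s0 L0.
move: (Gamma (k%:R + 1 / 2)) (Gamma lam) (Gamma (lam + 1 / 2))
  (Gamma (k%:R + lam)) (Gamma (k%:R + lam + 1 / 2)) => A B C D E.
move: (I lam _) (gegen_poly lam _).[1] (Num.sqrt pi) k`!%:R => J p s f.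
move=> E1 E2 A0 B0 C0 D0 E0 f0 s0 L0.
have -> : J = A * D / (f * E) by rewrite -E1; field; rewrite f0 E0.
have -> : p = s * D * E / (f * A * (B * C)).
  by rewrite -E2; field; rewrite f0 A0 B0 C0.
by field; rewrite s0 A0 B0 C0 D0 E0 f0 L0.
Qed.

Lemma gegen_poly_at1_gt0 (lam : R) n : 0 < lam -> 0 < (gegen_poly lam n).[1].
Proof.
move=> lam0; elim: n => [|n ih]; first by rewrite gegen_poly0 hornerC.
rewrite -(pmulr_rgt0 _ (ltr0Sn R n)) gegen_poly_at1 mulr_gt0//.
by rewrite ltr_wpDl ?mulr_gt0.
Qed.

(** From 2k to 2k + 1, both the moment and C_n(1) change by the factor
    2k + 2 lam, over 2k + 1 + 2 lam and 2k + 1 respectively, so the odd case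
    follows from the even one. *)
Lemma gegen_ratio_odd (n k : nat) (lam : R) : lam = n.+1%:R / 2 ->
  (gegen_c R k.*2.+1 n.+2)^-1 * I lam ('X * gegen_poly lam k.*2.+1) =
  alpha R k n.+2 *
    ((2 * k%:R + 1) * (2 * (2 * k%:R + 1 + lam)) / (2 * k%:R + 1 + 2 * lam)).
Proof.
move=> lamE; have lam0 : 0 < lam by rewrite lamE divr_gt0.
have lam2 : 1 / 2 <= lam by rewrite lamE ler_pM2r// ler1n.
have k0 := ler0n R k.
have k2 : k.*2%:R = 2 * k%:R :> R by rewrite -mul2n natrM.
have k2S : k.*2.+1%:R = 2 * k%:R + 1 :> R by rewrite -natr1 k2.
have a0 : 2 * k%:R + 1 + 2 * lam != 0.
  by rewrite gt_eqF// ltr_wpDl ?mulr_gt0// addr_ge0// mulr_ge0.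
have b0 : 2 * k%:R + 1 != 0 :> R by rewrite gt_eqF// ltr_wpDl// mulr_ge0.
have c0 : 2 * k%:R + 2 * lam != 0.
  by rewrite gt_eqF// ltr_wpDl ?mulr_gt0// mulr_ge0.
have d0 : lam + 2 * k%:R != 0 by rewrite gt_eqF// ltr_pwDl// mulr_ge0.
have e0 : lam + (2 * k%:R + 1) != 0 by rewrite gt_eqF// ltr_pwDl// addr_ge0// mulr_ge0.
have H := gegen_ratio_even k lamE; rewrite (gegen_cE _ lamE) k2 in H.
have HJ := gegen_moments lam2 k.*2; rewrite k2S k2 in HJ.
have HP := gegen_poly_at1 lam k.*2; rewrite k2S k2 in HP.
have p0 : (gegen_poly lam k.*2).[1] != 0 by rewrite gt_eqF// gegen_poly_at1_gt0.
have G0 : Num.sqrt pi * Gamma (lam + 1 / 2) / Gamma lam != 0.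
  rewrite !mulf_neq0 ?invr_eq0 ?(Gamma_halfn_neq0 lamE)//.
    by rewrite gt_eqF// sqrtr_gt0 pi_gt0.
  by apply: (@Gamma_halfn_neq0 _ n.+1); rewrite lamE -[n.+2%:R]natr1; field.
rewrite (gegen_cE _ lamE) k2S.
move: p0 G0 H HJ HP; move: (alpha _ _ _) (_ / Gamma lam) => al G.
move: (I lam ('X * _)) (I lam _) (gegen_poly _ k.*2.+1).[1] (gegen_poly _ _).[1] => J J' p p'.
move=> p0 G0 H HJ HP.
have -> : J = (2 * k%:R + 2 * lam) / (2 * k%:R + 1 + 2 * lam) * J'.
  by apply: (mulfI a0); rewrite HJ; field.
have -> : p = (2 * k%:R + 2 * lam) / (2 * k%:R + 1) * p'.
  by apply: (mulfI b0); rewrite HP; field.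
have -> : al = (G * p' / (lam + 2 * k%:R))^-1 * J' / (2 * (2 * k%:R + lam)).
  by rewrite H; field; rewrite addrC.
by field; rewrite a0 c0 p0 G0 [2 * k%:R + lam]addrC d0 ?e0 ?b0.
Qed.

End ClosedForms.

Unset Implicit Arguments.
Local Close Scope classical_set_scope.

Theorem proposition1 (R : realType) (a : R) (k q : nat)
    (ha : -1 <= a <= 1) (hq : (2 <= q)%N) :
  gegen_coef (2 * k + 1)%N q (psi a) =
    (alpha R k q * (((2 * k + 1)%:R * (4 * k + q + 1)%:R) / (2 * k + q)%:R) *
     (1 - a))%:E
  /\
  gegen_coef (2 * k)%N q (psi a) =
    (alpha R k q * (4 * k + q - 1)%:R * (1 + a))%:E.
Proof.
have -> : (2 * k)%N = k.*2 by rewrite mul2n.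
case: q hq => [//|[//|n _]].
pose lam : R := n.+1%:R / 2.
have lamE : lam = n.+1%:R / 2 by [].
have indexE : gegen_index R n.+2 = lam.
  by rewrite /gegen_index lamE -[n.+2%:R]natr1 addrK.
have lam2 : 1 / 2 <= lam by rewrite lamE ler_pM2r// ler1n.
have k2 : k.*2%:R = 2 * k%:R :> R by rewrite -mul2n natrM.
have k4 : (4 * k)%:R = 4 * k%:R :> R by rewrite natrM.
have l2 : n.+1%:R = 2 * lam by rewrite lamE; field.
rewrite addn1 !gegen_coefE// indexE.
split; congr EFin.
- rewrite (gegen_integral_odd lam2) mulr0 add0r mulrCA (gegen_ratio_odd k lamE).
  have -> : k.*2.+1%:R = 2 * k%:R + 1 :> R by rewrite -natr1 k2.
  have -> : (4 * k + n.+2 + 1)%:R = 4 * k%:R + 2 * lam + 2 :> R.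
    by rewrite natrD natrD k4 -[n.+2%:R]natr1 l2; ring.
  have -> : (k.*2 + n.+2)%:R = 2 * k%:R + 1 + 2 * lam :> R.
    by rewrite natrD k2 -[n.+2%:R]natr1 l2; ring.
  by ring.
- rewrite (gegen_moment_even lam2) mulr0 addr0 mulrCA (gegen_ratio_even k lamE).
  have -> : (4 * k + n.+2 - 1)%:R = 4 * k%:R + 2 * lam :> R.
    by rewrite addnS subn1/= natrD k4 l2.
  by ring.
Qed.
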